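(* Let $f:[a,b]\to\mathbb{R}$ be a continuous $\Phi$-H\''older function. Then for any $n\in\mathbb{N}$, $$\max\{f(a),f(b)\}-\frac{n}{2}\Phi\Big(\frac{b-a}{n}\Big)\leq\frac{1}{b-a}\mathcal{T}_{n}(f)\leq\min\{f(a),f(b)\}+\frac{n}{2}\Phi\Big(\frac{b-a}{n}\Big).$$
   Context: Let $a<b$ be real numbers. $\mathbb{N}$ denotes the set of positive integers and $\mathbb{R}_+$ the set of nonnegative reals. $\Phi:[0,b-a]\to\mathbb{R}_+$ is an arbitrary function (called the error function). A function $f:[a,b]\to\mathbb{R}$ is $\Phi$-monotone if $f(x)\leq f(y)+\Phi(y-x)$ for all $x,y\in[a,b]$ with $x<y$; it is $\Phi$-H\''older if both $f$ and $-f$ are $\Phi$-monotone, i.e. $|f(x)-f(y)|\leq\Phi(|y-x|)$ for all $x,y\in[a,b]$. For $n\in\mathbb{N}$ put $x_i=a+\frac{(b-a)i}{n}$, $i=0,1,\ldots,n$. The Trapezoidal rule is $$\mathcal{T}_{n}(f)=\frac{b-a}{2n}\Big[f(x_0)+2\sum_{i=1}^{n-1}f(x_i)+f(x_n)\Big].$$ *)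

(* Defs.v *)
From mathcomp Require Import all_boot all_order all_algebra.
From mathcomp Require Import all_classical all_reals all_analysis.

Set Implicit Arguments.
Unset Strict Implicit.
Unset Printing Implicit Defensive.

Import Order.TTheory GRing.Theory Num.Theory.

Local Open Scope ring_scope.

(* Functions on [0, b - a] or [a, b] are represented by total functions R -> R
   of which only the values on the interval are constrained and used. *)

Definition error_function (R : realType) (a b : R) (Phi : R -> R) : Prop :=
  forall t, t \in `[0, b - a] -> 0 <= Phi t.

Definition Phi_monotone (R : realType) (a b : R) (Phi f : R -> R) : Prop :=
  forall x y, x \in `[a, b] -> y \in `[a, b] -> x < y ->
    f x <= f y + Phi (y - x).

Definition Phi_holder (R : realType) (a b : R) (Phi f : R -> R) : Prop :=
  Phi_monotone a b Phi f /\ Phi_monotone a b Phi (fun x => - f x).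

Definition node (R : realType) (a b : R) (n i : nat) : R :=
  a + (b - a) * i%:R / n%:R.

Definition trapezoidal (R : realType) (a b : R) (n : nat) (f : R -> R) : R :=
  (b - a) / (2 * n%:R) *
  (f (node a b n 0) + 2 * \sum_(1 <= i < n) f (node a b n i)
   + f (node a b n n)).

(* Main.v *)
Require Import Defs.
From mathcomp Require Import all_boot all_order all_algebra.
From mathcomp Require Import all_classical all_reals all_analysis.
From mathcomp Require Import ring lra.

(** Write [h = (b - a) / n], [c = Phi h] and [g i] for the value of [f] at the
    [i]-th node.  The Hölder condition enters only between consecutive nodes,
    which are at distance [h]: it gives [`|g i.+1 - g i| <= c].  The bracket in
    the trapezoidal rule is the sum of [g i + g i.+1] over [i < n], hence [2 n]
    values of [g].  Compared with the end value [g 0] the two values of the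
    [i]-th term are off by at most [i * c] and [i.+1 * c], so the whole sum is
    within [(1 + 3 + ... + (2 n - 1)) * c = n ^ 2 * c] of [2 n * g 0]; by
    symmetry the same holds with [g n].  Dividing by [2 n] puts the mean
    [trapezoidal / (b - a)] within [n / 2 * c] of both [f a] and [f b], which is
    the claim: the lower bound for each end value is the bound with [max], the
    upper bound for each is the bound with [min]. *)

Set Implicit Arguments.
Unset Strict Implicit.
Unset Printing Implicit Defensive.

Import Order.TTheory GRing.Theory Num.Theory.
Import numFieldNormedType.Exports.

Local Open Scope classical_set_scope.
Local Open Scope ring_scope.

Lemma sum_trapezoid (R : comNzRingType) (g : nat -> R) (n : nat) :
  (0 < n)%N ->
  g 0%N + 2 * \sum_(1 <= i < n) g i + g n = \sum_(i < n) (g i + g i.+1).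
Proof.
case: n => // n _; elim: n => [|n IHn].
  by rewrite big_geq // big_ord1; ring.
by rewrite big_ord_recr /= -IHn big_nat_recr //=; ring.
Qed.

(** Splitting off the last term and moving the reference point from [g n] to
    [g n.+1] shifts [2 n + 1] copies of the reference value by at most [c] each,
    and [n ^ 2 + (2 n + 1) = (n + 1) ^ 2]. *)
Lemma dist_sum_trapezoid_last (R : realFieldType) (g : nat -> R) (c : R)
    (n : nat) :
  (forall i, (i < n)%N -> `|g i.+1 - g i| <= c) ->
  `|\sum_(i < n) (g i + g i.+1) - 2 * n%:R * g n| <= n%:R ^+ 2 * c.
Proof.
elim: n => [_|n IHn hg].
  by rewrite big_ord0 mulr0 mul0r subr0 normr0 expr0n mul0r.
have hn : `|g n.+1 - g n| <= c by exact: hg.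
have {}IHn := IHn (fun i lt_in => hg i (ltnW lt_in)).
rewrite big_ord_recr /= -(natr1 n).
set S := \sum_(i < n) _ in IHn *.
have -> : S + (g n + g n.+1) - 2 * (n%:R + 1) * g n.+1 =
  (S - 2 * n%:R * g n) - (2 * n%:R + 1) * (g n.+1 - g n) by ring.
have n0 : 0 <= 2 * n%:R + 1 :> R by rewrite addr_ge0 ?mulr_ge0.
apply: le_trans (ler_normB _ _) _; rewrite normrM (ger0_norm n0).
have -> : (n%:R + 1) ^+ 2 * c = n%:R ^+ 2 * c + (2 * n%:R + 1) * c by ring.
by rewrite lerD // ler_wpM2l.
Qed.

(** The mirror image of the preceding estimate: splitting off the first term and
    applying the induction hypothesis to the shifted sequence moves the
    reference point from [g 1] to [g 0]. *)
Lemma dist_sum_trapezoid_first (R : realFieldType) (g : nat -> R) (c : R)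
    (n : nat) :
  (forall i, (i < n)%N -> `|g i.+1 - g i| <= c) ->
  `|\sum_(i < n) (g i + g i.+1) - 2 * n%:R * g 0%N| <= n%:R ^+ 2 * c.
Proof.
elim: n g => [|n IHn] g hg.
  by rewrite big_ord0 mulr0 mul0r subr0 normr0 expr0n mul0r.
have h0 : `|g 1%N - g 0%N| <= c by exact: hg.
have {}IHn := IHn (fun i => g i.+1) (fun i lt_in => hg i.+1 lt_in).
rewrite big_ord_recl /= -(natr1 n).
set S := \sum_(i < n) _ in IHn *.
have -> : g 0%N + g 1%N + S - 2 * (n%:R + 1) * g 0%N =
  (S - 2 * n%:R * g 1%N) + (2 * n%:R + 1) * (g 1%N - g 0%N) by ring.
have n0 : 0 <= 2 * n%:R + 1 :> R by rewrite addr_ge0 ?mulr_ge0.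
apply: le_trans (ler_normD _ _) _; rewrite normrM (ger0_norm n0).
have -> : (n%:R + 1) ^+ 2 * c = n%:R ^+ 2 * c + (2 * n%:R + 1) * c by ring.
by rewrite lerD // ler_wpM2l.
Qed.

Lemma node_in_itv (R : realType) (a b : R) (n i : nat) :
  a <= b -> (i <= n)%N -> node a b n i \in `[a, b].
Proof.
move=> ab le_in; have ba0 : 0 <= b - a by rewrite subr_ge0.
rewrite in_itv /= /node -mulrA lerDl mulr_ge0 //= -lerBrDl ler_piMr //.
case: n le_in => [|n] le_in; first by rewrite invr0 mulr0.
by rewrite ler_pdivrMr ?mul1r ?ler_nat.
Qed.

Lemma nodeS_sub (R : realType) (a b : R) (n i : nat) :
  node a b n i.+1 - node a b n i = (b - a) / n%:R.
Proof.
rewrite /node opprD addrACA subrr add0r -mulrBl -mulrBr -natrB ?leqnSn //.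
by rewrite subSnn mulr1.
Qed.

Lemma Phi_holder_dist_nodes (R : realType) (a b : R) (Phi f : R -> R)
    (n i : nat) :
  a < b -> Phi_holder a b Phi f -> (i < n)%N ->
  `|f (node a b n i.+1) - f (node a b n i)| <= Phi ((b - a) / n%:R).
Proof.
move=> ab [up down] lt_in.
have itvi : node a b n i \in `[a, b] by apply: node_in_itv; [exact: ltW | exact: ltnW].
have itvS : node a b n i.+1 \in `[a, b] by apply: node_in_itv; [exact: ltW | by []].
have lt_nodes : node a b n i < node a b n i.+1.
  by rewrite -subr_gt0 nodeS_sub divr_gt0 ?subr_gt0 ?ltr0n ?(leq_trans _ lt_in).
have := up _ _ itvi itvS lt_nodes; have := down _ _ itvi itvS lt_nodes.
rewrite nodeS_sub ler_norml /= => le1 le2; apply/andP; split; lra.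
Qed.

Theorem corollary1 (R : realType) (a b : R) (hab : a < b)
    (Phi : R -> R) (hPhi : error_function a b Phi)
    (f : R -> R) (hcont : {within `[a, b], continuous f})
    (hf : Phi_holder a b Phi f) (n : nat) (hn : (0 < n)%N) :
  Num.max (f a) (f b) - n%:R / 2 * Phi ((b - a) / n%:R)
    <= 1 / (b - a) * trapezoidal a b n f
  /\ 1 / (b - a) * trapezoidal a b n f
    <= Num.min (f a) (f b) + n%:R / 2 * Phi ((b - a) / n%:R).
Proof.
have n0 : 0 < n%:R :> R by rewrite ltr0n.
have steps i : (i < n)%N -> _ := @Phi_holder_dist_nodes R a b Phi f n i hab hf.
pose g i := f (node a b n i).
have node0 : g 0%N = f a by rewrite /g /node mulr0 mul0r addr0.
have noden : g n = f b by rewrite /g /node mulfK ?gt_eqF // addrC subrK.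
set c := Phi _ in steps *.
have first := @dist_sum_trapezoid_first R g c n steps.
have last := @dist_sum_trapezoid_last R g c n steps.
rewrite node0 in first; rewrite noden in last.
set S := \sum_(i < n) _ in first last.
have -> : 1 / (b - a) * trapezoidal a b n f = S / (2 * n%:R).
  rewrite /trapezoidal (sum_trapezoid g hn) -/S.
  by field; rewrite gt_eqF //= subr_eq0 gt_eqF.
have mean_dist z : `|S - 2 * n%:R * z| <= n%:R ^+ 2 * c ->
    z - n%:R / 2 * c <= S / (2 * n%:R) <= z + n%:R / 2 * c.
  rewrite ler_distl ler_pdivlMr ?ler_pdivrMr ?mulr_gt0 //.
  have -> : (z - n%:R / 2 * c) * (2 * n%:R) = 2 * n%:R * z - n%:R ^+ 2 * c.
    by field.
  by have -> : (z + n%:R / 2 * c) * (2 * n%:R) = 2 * n%:R * z + n%:R ^+ 2 * c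
    by field.
have /andP[la ua] := mean_dist _ first.
have /andP[lb ub] := mean_dist _ last.
split; first by rewrite lerBlDr ge_max -!lerBlDr la lb.
by rewrite -lerBlDr le_min !lerBlDr ua ub.
Qed.
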